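(* For any real numbers $c, \alpha>0$, there exist a real $\epsilon>0$ and an integer $C>0$ such that the following holds for every sufficiently large integer $n$. Let $G$ be a graph of order $n$ such that $\deg(v)=(1\pm\epsilon)c n$ for every $v\in V(G)$. Then there exists a collection of at most $C$ vertex-disjoint cycles in $G$ whose union covers all but at most $\alpha n$ vertices of $G$.
   Context: Graphs are finite and simple. For reals $a, b, c$, one writes $a=(1\pm b)c$ if there exists a real $x\in (1-b, 1+b)$ such that $a=xc$. *)

(* Defs.v *)
From HB Require Import structures.
From mathcomp Require Import all_boot all_order all_algebra.
From mathcomp Require Import reals.
Set Implicit Arguments. Unset Strict Implicit. Unset Printing Implicit Defensive.
Import Order.TTheory GRing.Theory Num.Theory.
Local Open Scope ring_scope.

Record sgraph := SGraph {
  vertex :> finType;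
  adj : rel vertex;
  adj_sym : symmetric adj;
  adj_irrefl : irreflexive adj }.

Definition deg (G : sgraph) (v : G) : nat := #|[set w | adj v w]|.

(* [is_pm a b c] stands for "a = (1 ± b) c". *)
Definition is_pm (R : realType) (a b c : R) : Prop :=
  exists x : R, 1 - b < x < 1 + b /\ a = x * c.

(* A cycle is given by the sequence of its vertices in cyclic order. The bound
   on the size is needed: [ucycle] also accepts the empty sequence and, for two
   adjacent vertices, the sequence of these two. *)
Definition is_cycle (G : sgraph) (s : seq G) : Prop :=
  ucycle (@adj G) s /\ (2 < size s)%N.

Definition vdisjoint (G : sgraph) (cs : seq (seq G)) : bool :=
  pairwise (fun s t : seq G => [disjoint s & t]) cs.

Definition uncovered (G : sgraph) (cs : seq (seq G)) : {set G} :=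
  [set v | all (fun s : seq G => v \notin s) cs].

(* Main.v *)
Require Import Defs.
From HB Require Import structures.
From mathcomp Require Import all_boot all_order all_algebra.
From mathcomp Require Import reals.
From mathcomp Require Import zify ring lra.
Set Implicit Arguments. Unset Strict Implicit. Unset Printing Implicit Defensive.

(** A second-moment argument colours the vertices with [r] colours so that,
    outside a set [B] of bounded size, every vertex has about [c n / r]
    neighbours in every colour. The bipartite graphs between consecutive colours
    are then almost regular, so Hall's theorem yields an almost perfect matching
    from each colour to the next one; since colours increase along the matching
    edges, their union is a union of only about [n / r] paths. The last [w]
    colours are set aside as a reservoir [W]. Each vertex sees a proportion about
    [c] of [W], so among any [k] vertices, [k] a constant, two have a common
    unused neighbour in [W]. Applied to the first vertices of [k] paths this
    merges two paths into one; applied to [k] vertices at mutual distance at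
    least [q], of order [n], on a long path it cuts a cycle of length at least
    [q] out of that path. When neither move is possible there are fewer than [k]
    paths, each shorter than [k q]; each cycle has at least [q] vertices, so
    their number is bounded. *)

(** * Equidistributed colourings *)

(** Pair each colouring with a spare colour. Swapping the spare colour with the colour of [a] is an
    involution that leaves [b] alone, so [f a] may be replaced by a free colour, which agrees with
    [f b] exactly once in [r]. *)
Lemma sum_collisions (V : finType) (r : nat) (a b : V) : a != b ->
  r * (\sum_(f : {ffun V -> 'I_r}) (f a == f b)) = #|{ffun V -> 'I_r}|.
Proof.
move=> neq_ab.
pose upd (x : {ffun V -> 'I_r} * 'I_r) :=
  ([ffun v => if v == a then x.2 else x.1 v], x.1 a).
have updK : involutive upd.
  case=> f j; congr pair => /=; last by rewrite ffunE eqxx.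
  by apply/ffunP=> v; rewrite !ffunE; case: eqP => [->|].
have constE n : r * n = \sum_(j < r) n by rewrite sum_nat_const card_ord.
rewrite big_distrr /=; under eq_bigr do rewrite constE.
rewrite (pair_big xpredT xpredT (fun (f : {ffun V -> 'I_r}) (j : 'I_r) => (f a == f b : nat))) /=.
rewrite (reindex_inj (inv_inj updK)) /=.
under eq_bigr do rewrite !ffunE eqxx [b == a]eq_sym (negPf neq_ab).
rewrite -(pair_big xpredT xpredT (fun (f : {ffun V -> 'I_r}) (j : 'I_r) => (j == f b : nat))) /=.
rewrite -sum1_card; apply: eq_bigr => f _.
by rewrite (bigD1 (f b)) //= eqxx big1 // => j /negPf ->.
Qed.

(** First moment. The sum of squares counts the ordered monochromatic pairs in [A i]; on average
    over all colourings the diagonal contributes [#|A i|] and each other pair [1 / r]. Averaging the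
    sum over [i] gives one colouring for all the sets at once. *)
Lemma exists_equidistributed_coloring (V I : finType) (r : nat) (A : I -> {set V}) :
  0 < r -> exists f : {ffun V -> 'I_r},
    \sum_i r * (\sum_(j < r) #|A i :&: [set v | f v == j]| ^ 2)
      <= \sum_i (#|A i| ^ 2 + r * #|A i|).
Proof.
move=> r_gt0; pose B := \sum_i (#|A i| ^ 2 + r * #|A i|).
pose F (f : {ffun V -> 'I_r}) := \sum_i r * (\sum_(j < r) #|A i :&: [set v | f v == j]| ^ 2).
change (exists f, F f <= B).
apply/existsP; apply: contraT; rewrite negb_exists => /forallP big.
pose T := #|{ffun V -> 'I_r}|.
have T_gt0 : 0 < T by apply/card_gt0P; exists [ffun=> Ordinal r_gt0].
have squares (f : {ffun V -> 'I_r}) (S : {set V}) :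
    \sum_(j < r) #|S :&: [set v | f v == j]| ^ 2
      = \sum_(a in S) \sum_(b in S) (f a == f b).
  rewrite (partition_big (fun a => f a) xpredT) //=; apply: eq_bigr => j _.
  rewrite -mulnn -[X in X * _]sum1_card big_distrl /=.
  apply: eq_big => [a|a]; rewrite !inE // => /andP[aS /eqP <-].
  rewrite mul1n -sum1_card [RHS]big_mkcond [LHS]big_mkcond.
  apply: eq_bigr => b _; rewrite !inE eq_sym.
  by case: (b \in S) => //=; case: eqP.
have sumF : \sum_f F f <= T * B.
  rewrite /F exchange_big /= /B big_distrr /=; apply: leq_sum => i _.
  under eq_bigr do rewrite squares.
  rewrite -big_distrr /= exchange_big /= big_distrr /=.
  have -> : T * (#|A i| ^ 2 + r * #|A i|) = \sum_(a in A i) T * (#|A i| + r).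
    by rewrite sum_nat_const; lia.
  apply: leq_sum => a aA; rewrite exchange_big /= (bigD1 a aA) /= mulnDr mulnDr addnC.
  apply: leq_add.
    rewrite big_distrr /=; under eq_bigr => b /andP[bA nb].
      rewrite sum_collisions 1?eq_sym //. over.
    rewrite sum_nat_const mulnC leq_mul2l; apply/orP; right.
    by apply/subset_leq_card/subsetP => b /andP[].
  under eq_bigr do rewrite eqxx.
  by rewrite sum1_card mulnC.
have : \sum_(f : {ffun V -> 'I_r}) B.+1 <= \sum_f F f.
  by apply: leq_sum => f _; have := big f; rewrite -ltnNge.
rewrite sum_nat_const -/T; nia.
Qed.

(** * Hall's theorem *)

Definition neighbors (A B : finType) (N : A -> {set B}) (S : {set A}) : {set B} :=
  \bigcup_(a in S) N a.

(** Induction on [#|S|]. If a nonempty proper subset [T] is tight, [T] and its complement are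
    matched separately; otherwise every such subset has a spare neighbour, so one element can be
    matched arbitrarily and removed. *)
Lemma hall (A B : finType) (N : A -> {set B}) (S : {set A}) :
  (forall T : {set A}, T \subset S -> #|T| <= #|neighbors N T|) ->
  exists m : A -> option B,
    (forall a, a \in S -> exists2 b, m a = Some b & b \in N a) /\
    {in S &, injective m}.
Proof.
have [n] := ubnP #|S|; elim: n S N => // n IHn S N ltSn hallS.
have [->|[a0 a0S]] := set_0Vmem S.
  by exists (fun=> None); split=> [a|a b]; rewrite inE.
have [/existsP[T /and3P[sTS T0 /eqP cardT]]|noT] := boolP
  [exists T : {set A}, [&& T \proper S, T != set0 & #|neighbors N T| == #|T|]].
- have ltT := proper_card sTS; have sTS' := proper_sub sTS.
  have [||m1 [m1P m1I]] := IHn T N.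
  + by apply: leq_trans ltT _.
  + by move=> U sUT; apply: hallS; apply: subset_trans sUT sTS'.
  (* Hall's condition survives the deletion of [neighbors N T]: apply it to [T :|: U] and subtract
     the tight equality for [T]. *)
  pose N2 a := N a :\: neighbors N T.
  have [||m2 [m2P m2I]] := IHn (S :\: T) N2.
  + have := cardsID T S; rewrite (setIidPr sTS').
    by move: T0 ltSn; rewrite -card_gt0; lia.
  + move=> U sU; have := hallS (T :|: U).
    have sUS : U \subset S by apply: subset_trans sU (subsetDl _ _).
    rewrite subUset sTS' sUS => /(_ isT).
    have dTU : [disjoint T & U].
      by move: sU; rewrite subsetD disjoint_sym => /andP[].
    have -> : #|T :|: U| = #|T| + #|U|.
      by rewrite cardsU (disjoint_setI0 dTU) cards0 subn0.
    have -> : neighbors N (T :|: U) = neighbors N T :|: neighbors N2 U.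
      apply/setP=> b; rewrite !inE; apply/bigcupP/orP.
        case=> a; rewrite inE => /orP[aT|aU] bN; first by left; apply/bigcupP; exists a.
        have [bT|bT] := boolP (b \in neighbors N T); [by left|right].
        by apply/bigcupP; exists a => //; rewrite inE bT.
      case=> /bigcupP[a aU bN]; exists a; rewrite ?inE ?aU ?orbT //.
      by move: bN; rewrite inE => /andP[].
    by have [] := leq_card_setU (neighbors N T) (neighbors N2 U); lia.
  exists (fun a => if a \in T then m1 a else m2 a); split.
    move=> a aS; case: ifP => aT; first exact: m1P.
    have [|b mb] := m2P a; first by rewrite inE aT.
    by rewrite inE => /andP[_ bN]; exists b.
  have neqm a b : a \in T -> b \in S :\: T -> m1 a <> m2 b.
    move=> aT bST; have [x mx xN] := m1P a aT.
    have [y my] := m2P b bST; rewrite inE => /andP[yT _].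
    rewrite mx my => -[exy]; move: yT; rewrite -exy => /negP; apply.
    by apply/bigcupP; exists a.
  move=> a b aS bS; case: ifP => aT; case: ifP => bT; first exact: m1I.
  + by move/neqm => /(_ aT) H; case: H; rewrite inE bT.
  + by move/esym/neqm => /(_ bT) H; case: H; rewrite inE aT.
  + by apply: m2I; rewrite inE ?aT ?bT.
- have strict (T : {set A}) : T \proper S -> T != set0 -> #|T| < #|neighbors N T|.
    move=> pT T0; rewrite ltn_neqAle hallS ?proper_sub // andbT eq_sym.
    by apply: contraNN noT => ?; apply/existsP; exists T; apply/and3P.
  have [b0 b0N] : exists b, b \in N a0.
    have := hallS [set a0]; rewrite sub1set a0S /neighbors big_set1 cards1 => /(_ isT).
    by rewrite card_gt0 => /set0Pn.
  pose N2 a := N a :\ b0.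
  have ltS' : #|S :\ a0| < n by move: ltSn; rewrite (cardsD1 a0) a0S.
  have [|m2 [m2P m2I]] := IHn (S :\ a0) N2 ltS'.
    move=> U sU; have [->|U0] := eqVneq U set0; first by rewrite cards0.
    have pU : U \proper S.
      apply: sub_proper_trans sU _; exact: properD1.
    have := strict U pU U0.
    (* Deleting [b0] costs at most one neighbour, which the strict inequality pays for. *)
    have sub : neighbors N U \subset b0 |: neighbors N2 U.
      apply/subsetP=> b /bigcupP[a aU bN]; rewrite !inE.
      by case: eqVneq => //= nb; apply/bigcupP; exists a; rewrite // !inE nb.
    have := subset_leq_card sub; have := cardsU1 b0 (neighbors N2 U).
    by case: (_ \notin _) => /=; lia.
  exists (fun a => if a == a0 then Some b0 else m2 a); split.
    move=> a aS; case: eqVneq => [->|na]; first by exists b0.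
    have [|b mb] := m2P a; first by rewrite !inE na.
    by rewrite !inE => /andP[_ bN]; exists b.
  have neqm b : b \in S -> b != a0 -> m2 b <> Some b0.
    move=> bS nb; have [|y my] := m2P b; first by rewrite !inE nb.
    by rewrite !inE => /andP[yb _]; rewrite my => -[e]; rewrite e eqxx in yb.
  move=> a b aS bS; case: (eqVneq a a0) => [->|na]; case: (eqVneq b a0) => [->|nb] //.
  + by move/esym/neqm => /(_ bS nb).
  + by move/neqm => /(_ aS na).
  + by apply: m2I; rewrite !inE ?na ?nb.
Qed.

(** Add [d] dummy vertices adjacent to everything and apply [hall]. The elements matched to dummies
    become the unmatched ones, and they inject into the dummies. *)
Lemma hall_deficiency (A B : finType) (N : A -> {set B}) (S : {set A}) (d : nat) :
  (forall T : {set A}, T \subset S -> #|T| <= #|neighbors N T| + d) ->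
  exists m : A -> option B,
    [/\ forall a b, m a = Some b -> a \in S /\ b \in N a,
        forall a a' b, m a = Some b -> m a' = Some b -> a = a' &
        #|[set a in S | m a == None]| <= d].
Proof.
move=> hallS.
pose N' a : {set B + 'I_d} := [set x | if x is inl b then b \in N a else true].
have [T sTS|m [mP mI]] := @hall A (B + 'I_d)%type N' S.
  have [->|[t tT]] := set_0Vmem T; first by rewrite cards0.
  apply: leq_trans (hallS T sTS) _.
  have -> : #|neighbors N T| + d = #|[set x : B + 'I_d | if x is inl b then b \in neighbors N T else true]|.
    rewrite -[RHS]sum1_card big_sumType /= -[in LHS](card_ord d) -!sum1_card.
    by congr (_ + _); apply: eq_bigl => b; rewrite !inE.
  apply/subset_leq_card/subsetP => -[b|i]; rewrite inE => H.
    by have /bigcupP[a aT bN] := H; apply/bigcupP; exists a; rewrite ?inE.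
  by apply/bigcupP; exists t; rewrite ?inE.
exists (fun a => if a \in S then if m a is Some (inl b) then Some b else None else None).
split.
- move=> a b; case: ifP => // aS; have [x mx] := mP a aS; rewrite mx inE.
  by case: x mx => // b' _ ? [<-].
- move=> a a' b; case: ifP => // aS; case: ifP => // a'S.
  case ma: (m a) => [[x|]|] // [e1]; case ma': (m a') => [[x'|]|] // [e2].
  by apply: mI => //; rewrite ma ma' e1 e2.
- set D := [set a in S | _].
  have inj : {in D &, injective m}.
    by move=> a b; rewrite !inE => /andP[aS _] /andP[bS _]; apply: mI.
  rewrite -(card_in_imset inj).
  apply: (@leq_trans #|[set Some (inr i : B + 'I_d) | i : 'I_d]|).
    apply/subset_leq_card/subsetP => y /imsetP[a]; rewrite !inE => /andP[aS] + ->.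
    rewrite aS; have [x mx _] := mP a aS; rewrite mx.
    by case: x mx => // i _ _; apply/imsetP; exists i.
  by rewrite card_imset ?card_ord // => i j [].
Qed.

(** * Paths along a layered matching *)

(** Uniqueness of the concatenation says both that each path is simple and that the paths are
    disjoint. Excluding [[::]] gives every path a first vertex. *)
Definition path_family (G : sgraph) (ps : seq (seq G)) : Prop :=
  [/\ uniq (flatten ps), forall p, p \in ps -> sorted (@adj G) p & [::] \notin ps].

(** Induction removing a vertex [v] of lowest level, which no [g]-edge from [S] enters. By
    injectivity its successor has no other predecessor, hence starts a path by the last clause, and
    [v] is put in front of it. That clause is there for this induction. *)
Lemma layered_paths (G : sgraph) (lev : G -> nat) (g : G -> option G) (S : {set G}) :
  (forall v x, v \in S -> g v = Some x -> [/\ x \in S, adj v x & lev v < lev x]) ->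
  (forall v v' x, g v = Some x -> g v' = Some x -> v = v') ->
  exists ps : seq (seq G),
    [/\ path_family ps, flatten ps =i S, size ps = #|[set v in S | g v == None]| &
        forall x, x \in S -> (forall v, v \in S -> g v <> Some x) ->
          exists p, x :: p \in ps].
Proof.
move=> + ginj; have [n] := ubnP #|S|; elim: n S => // n IHn S ltSn gS.
have [S0|[v0 v0S]] := set_0Vmem S.
  exists [::]; split=> //.
  - by move=> x; rewrite S0 !inE.
  - by rewrite (_ : [set _ in _ | _] = set0) ?cards0 //; apply/setP=> x; rewrite S0 !inE.
  - by move=> x; rewrite S0 inE.
case: (arg_minnP lev v0S) => v vS' vmin; have {vS'} vS : v \in S := vS'.
have [||ps [[ups sps nps] cps zps hps]] := IHn (S :\ v).
- by move: ltSn; rewrite (cardsD1 v) vS.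
- move=> u x; rewrite !inE => /andP[nuv uS] gu; have [xS aux lux] := gS u x uS gu.
  split=> //; rewrite xS andbT; apply: contraTneq lux => ->.
  by rewrite -leqNgt vmin.
have vnf : v \notin flatten ps by rewrite cps !inE eqxx.
have cover1 (x : G) : (x == v) || (x \in S :\ v) = (x \in S).
  by rewrite !inE; case: eqVneq => // ->.
case gv: (g v) => [x|].
- have [xS avx lvx] := gS v x vS gv.
  have [|u|p xp] := hps x.
  + by rewrite !inE xS andbT; apply: contraTneq lvx => ->; rewrite ltnn.
  + rewrite !inE => /andP[/eqP nuv _] gu; apply: nuv; exact: ginj gu gv.
  have pps : perm_eq ps ((x :: p) :: rem (x :: p) ps) by apply: perm_to_rem.
  have pfl : perm_eq (flatten ps) (flatten ((x :: p) :: rem (x :: p) ps)).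
    exact: perm_flatten.
  have flE : flatten ((v :: x :: p) :: rem (x :: p) ps)
           = v :: flatten ((x :: p) :: rem (x :: p) ps) by [].
  exists ((v :: x :: p) :: rem (x :: p) ps); split.
  + split.
    * by rewrite flE cons_uniq -(perm_uniq pfl) -(perm_mem pfl) vnf.
    * move=> q; rewrite inE => /orP[/eqP ->|/mem_rem]; last exact: sps.
      by rewrite /= avx /=; apply: (sps _ xp).
    * by rewrite inE /=; apply: contra nps => /mem_rem.
  + by move=> y; rewrite flE inE -(perm_mem pfl) cps cover1.
  + rewrite /= size_rem // prednK; last by case: (ps) xp.
    rewrite zps; apply: eq_card => y; rewrite !inE.
    by case: eqVneq => [->|] //=; rewrite gv andbF.
  + move=> y yS hy; have [->|nyv] := eqVneq y v; first by exists (x :: p); rewrite inE eqxx.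
    have [||q yq] := hps y; first by rewrite !inE nyv.
      by move=> u; rewrite !inE => /andP[_]; apply: hy.
    have nxy : y != x by apply/eqP=> exy; apply: (hy v vS); rewrite gv exy.
    exists q; move: yq; rewrite (perm_mem pps) !inE => /orP[/eqP[/eqP]|->]; last by rewrite orbT.
    by rewrite (negPf nxy).
- exists ([:: v] :: ps); split.
  + split.
    * by rewrite /= vnf.
    * by move=> q; rewrite inE => /orP[/eqP ->|]; last exact: sps.
    * by rewrite inE.
  + by move=> y; rewrite /= inE cps cover1.
  + rewrite /= zps [RHS](cardsD1 v) inE vS gv eqxx; congr _.+1.
    by apply: eq_card => y; rewrite !inE andbA.
  + move=> y yS hy; have [->|nyv] := eqVneq y v; first by exists [::]; rewrite inE eqxx.
    have [||q yq] := hps y; first by rewrite !inE nyv.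
      by move=> u; rewrite !inE => /andP[_]; apply: hy.
    by exists q; rewrite inE yq orbT.
Qed.

(** * Merging paths and cutting cycles through a reservoir *)

(** Double counting of the pairs [(i, w)] with [w \in F i]: if no [w] were hit twice, there would be
    at most [#|W|] pairs. *)
Lemma pigeonhole_sets (V : finType) (W : {set V}) (k : nat) (F : 'I_k -> {set V}) :
  (forall i, F i \subset W) -> #|W| < \sum_i #|F i| ->
  exists (i j : 'I_k) (w : V), [/\ i < j, w \in F i & w \in F j].
Proof.
move=> FW; have -> : \sum_i #|F i| = \sum_(w in W) #|[set i | w \in F i]|.
  under eq_bigr do rewrite -sum1_card.
  under [RHS]eq_bigr do rewrite -sum1_card.
  rewrite (exchange_big_dep (mem W)) => [|i w _]; last by move=> /=; apply/subsetP.
  by apply: eq_bigr => w _; apply: eq_bigl => i; rewrite inE.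
move=> ltW; have [/existsP[w /andP[wW]]|] :=
    boolP [exists w, (w \in W) && (1 < #|[set i | w \in F i]|)].
  case/card_gt1P=> i [j]; rewrite !inE => -[wi wj]; rewrite neq_ltn.
  by case/orP=> ltij; [exists i, j, w | exists j, i, w].
rewrite negb_exists => /forallP le1; case/negP: (ltnn #|W|).
apply: leq_trans ltW _; rewrite -[leqRHS]sum1_card; apply: leq_sum => w wW.
by have := le1 w; rewrite wW /= -leqNgt.
Qed.

Lemma perm_two_nth (T : eqType) (x0 : T) (s : seq T) (i j : nat) :
  i < j < size s -> exists t, perm_eq s (nth x0 s i :: nth x0 s j :: t).
Proof.
case/andP=> ltij ltj.
exists (take i s ++ drop i.+1 (take j s) ++ drop j.+1 s).
have E1 : s = take j s ++ nth x0 s j :: drop j.+1 s by rewrite -drop_nth // cat_take_drop.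
have E2 : take j s = take i s ++ nth x0 s i :: drop i.+1 (take j s).
  rewrite -[in LHS](cat_take_drop i (take j s)) take_takel 1?ltnW //.
  by congr (_ ++ _); rewrite (drop_nth x0) ?nth_take ?size_take ?ltj.
apply/permP=> a; rewrite {1}E1 {1}E2 !count_cat /= !count_cat /=; lia.
Qed.

Lemma sorted_join (T : Type) (e : rel T) (s : seq T) (x w : T) (t : seq T) :
  sorted e (rcons s x) -> e x w -> sorted e (w :: t) ->
  sorted e (rcons s x ++ w :: t).
Proof.
case: s => [|z s] /=; first by move=> _ -> ->.
by rewrite cat_path last_rcons /= => -> -> ->.
Qed.

Section Assemble.
(** [W] is the reservoir, [Gd] the set of well-behaved vertices, [X] the set that paths and cycles
    must keep covering, [m] the initial number of paths and [C] the bound on the number of cycles.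
    By [degW], any [k] good vertices have two with a common neighbour in [W] even after [m + C.*2]
    vertices of [W] are used; its strictness forces the truncated difference to be positive. *)
Variables (G : sgraph) (x0 : G) (W Gd X : {set G}) (k q m C : nat).
Hypotheses (k_gt0 : 0 < k) (q_gt0 : 0 < q).
Hypothesis WGd : W \subset Gd.
Hypothesis degW : forall v, v \in Gd ->
  #|W| < k * (#|[set w in W | adj v w]| - (m + C.*2)).
Hypothesis cardG : #|G| < q * C.+1.

(* [U] is the used part of [W]. A merge adds one vertex to [U] and removes one
   path; a cut adds one vertex to [U], one cycle and at most one path. Hence the
   bound on [#|U| + size ps], which keeps enough of [W] unused. *)
Definition linkage_state (ps cs : seq (seq G)) (U : {set G}) : Prop :=
  let z := flatten ps ++ flatten cs in
  [/\ uniq z /\ {subset z <= Gd},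
      (forall p, p \in ps -> sorted (@adj G) p) /\ [::] \notin ps,
      forall s, s \in cs -> is_cycle s /\ q <= size s,
      U \subset W /\ #|U| + size ps <= m + (size cs).*2 &
      (forall x, x \in z -> x \in W -> x \in U) /\ (forall x, x \in X -> x \in z)].

(** The cycles are disjoint with at least [q] vertices each, and [cardG] leaves no room for [C.+1]
    of them. *)
Lemma linkage_state_cycles ps cs U : linkage_state ps cs U -> size cs <= C.
Proof.
case=> -[uz _] _ cyc _ _; rewrite leqNgt; apply/negP => ltC.
have : size (flatten cs) <= #|G|.
  move: uz; rewrite cat_uniq => /and3P[_ _ uz].
  by rewrite -(card_uniqP uz) max_card.
have : q * size cs <= size (flatten cs).
  elim: (cs) cyc => [|s ss IH] cyc; first by rewrite muln0.
  rewrite /= size_cat mulnS leq_add //.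
    by have [] := cyc s (mem_head _ _).
  by apply: IH => t ts; apply: cyc; rewrite inE ts orbT.
by move: cardG; nia.
Qed.

Lemma linkage_state_link ps cs U (s : 'I_k -> G) :
  linkage_state ps cs U -> (forall i, s i \in flatten ps) ->
  exists (i j : 'I_k) (w : G),
    [/\ i < j, w \in W :\: U, adj (s i) w & adj (s j) w].
Proof.
move=> st sP; have szC := linkage_state_cycles st.
case: st => -[_ zGd] _ _ [UW leU] _.
pose F i := [set w in W | adj (s i) w] :\: U.
have [i||i [j [w []]]] := @pigeonhole_sets G W k F.
- by apply/subsetP=> w; rewrite !inE => /and3P[].
- pose o : 'I_k := Ordinal k_gt0.
  have low i : #|[set w in W | adj (s i) w]| - (m + C.*2) <= #|F i|.
    by rewrite cardsD; have := subset_leq_card (subsetIr [set w in W | adj (s i) w] U); lia.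
  have big i : #|W| < k * #|F i|.
    have sG : s i \in Gd by apply: zGd; rewrite mem_cat sP.
    by apply: leq_trans (degW sG) _; rewrite leq_mul2l low orbT.
  case: (@arg_minnP 'I_k o xpredT (fun i => #|F i|)) => // i _ imin.
  apply: leq_trans (big i) _; rewrite -{1}(card_ord k) -sum_nat_const.
  by apply: leq_sum => j _; apply: imin.
- rewrite !inE => ltij /and3P[wU wW si] /and3P[_ _ sj].
  by exists i, j, w; rewrite !inE wU.
Qed.

(** Bookkeeping common to both moves: [w] is new because every reservoir vertex already on a path or
    cycle lies in [U], and the last hypothesis absorbs the growth of [U] by one. *)
Lemma linkage_state_step (ps cs : seq (seq G)) U (ps' cs' : seq (seq G)) w :
  linkage_state ps cs U -> w \in W :\: U ->
  perm_eq (flatten ps' ++ flatten cs') (w :: (flatten ps ++ flatten cs)) ->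
  (forall p, p \in ps' -> sorted (@adj G) p) -> [::] \notin ps' ->
  (forall s, s \in cs' -> is_cycle s /\ q <= size s) ->
  (size ps').+1 + (size cs).*2 <= size ps + (size cs').*2 ->
  linkage_state ps' cs' (w |: U).
Proof.
case=> -[uz zGd] _ _ [UW leU] [zU Xz] /setDP[wW wU] pz sps nps cyc le.
have wz : w \notin flatten ps ++ flatten cs by apply: contra wU => /zU; apply.
split=> //.
- split; first by rewrite (perm_uniq pz) /= wz.
  by move=> x; rewrite (perm_mem pz) inE => /orP[/eqP ->|/zGd //]; apply: (subsetP WGd).
- split; first by rewrite subUset sub1set wW.
  by rewrite cardsU1 wU /=; lia.
- split=> [x|x /Xz xz]; last by rewrite (perm_mem pz) inE xz orbT.
  rewrite (perm_mem pz) inE => /orP[/eqP -> _|xz xW]; first by rewrite setU11.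
  by rewrite inE (zU _ xz xW) orbT.
Qed.

Lemma linkage_join ps cs U : linkage_state ps cs U -> k <= size ps ->
  exists (ps' : seq (seq G)) w, w \in W :\: U /\ linkage_state ps' cs (w |: U).
Proof.
move=> st leK; have [_ [sps nps] cyc _ _] := st.
have nth_ps (i : 'I_k) : nth [::] ps i \in ps by rewrite mem_nth // (leq_trans _ leK).
have [i|i [j [w [ltij wW ai aj]]]] :=
    @linkage_state_link ps cs U (fun i => head x0 (nth [::] ps i)) st.
  apply/flattenP; exists (nth [::] ps i) => //; move: (nth_ps i).
  case: (nth _ _ _) => [|y p]; last by rewrite mem_head.
  by rewrite (negPf nps).
have [|t pt] := @perm_two_nth _ [::] ps i j; first by rewrite ltij (leq_trans _ leK).
move: (nth_ps i) (nth_ps j) ai aj pt.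
case: (nth _ ps i) => [|x a]; first by rewrite (negPf nps).
case: (nth _ ps j) => [|y b]; first by rewrite (negPf nps).
move=> xa yb /= ai aj pt; exists ((rev (x :: a) ++ w :: y :: b) :: t), w; split=> //.
have tP p : p \in t -> p \in ps by rewrite (perm_mem pt) !inE => ->; rewrite !orbT.
apply: (linkage_state_step st wW) => //.
- apply/permP => P; have /permP/(_ P) := perm_flatten pt.
  rewrite /= !(count_cat, count_rev) /= => ->; rewrite !(count_cat, count_rev) /=; lia.
- move=> p; rewrite inE => /orP[/eqP ->|/tP]; last exact: sps.
  rewrite rev_cons; apply: sorted_join => //.
    rewrite -rev_cons rev_sorted (eq_sorted (e' := @adj G)) ?sps //.
    by move=> u v; rewrite adj_sym.
  by rewrite /= adj_sym aj; apply: (sps _ yb).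
- rewrite inE negb_or (contra (tP _) nps) andbT.
  by case: (rev _).
- by move/perm_size: pt => /= ->; lia.
Qed.

Lemma linkage_cut ps cs U p : linkage_state ps cs U -> p \in ps -> k * q <= size p ->
  exists (ps' cs' : seq (seq G)) w, w \in W :\: U /\ linkage_state ps' cs' (w |: U).
Proof.
move=> st pps leK; have [_ [sps nps] cyc _ _] := st.
have ltp (i : 'I_k) : i * q < size p.
  by apply: leq_trans leK; rewrite ltn_mul2r q_gt0 ltn_ord.
have [i|i [j [w [ltij wW ai aj]]]] :=
    @linkage_state_link ps cs U (fun i => nth x0 p (i * q)) st.
  by apply/flattenP; exists p => //; rewrite mem_nth.
(* The successor makes the segment contain both of its end vertices. *)
pose l := ((j - i) * q).+1.
pose a := take (i * q) p; pose b := take l (drop (i * q) p).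
pose d := drop l (drop (i * q) p).
have pE : p = a ++ b ++ d by rewrite !cat_take_drop.
have szb : size b = l.
  rewrite size_take size_drop; have := ltp j; rewrite /l mulnBl => ltj.
  by have := leq_mul2r q i j; case: ifP; nia.
have sp : sorted (@adj G) p by apply: sps.
have [sa [sb sd]] : sorted (@adj G) a /\ sorted (@adj G) b /\ sorted (@adj G) d.
  move: sp; rewrite pE => sp; have [? /cat_sorted2[]] := cat_sorted2 sp; by split.
have nthb n : n < l -> nth x0 b n = nth x0 p (i * q + n).
  by move=> ltn; rewrite nth_take // nth_drop.
have lenq : q < l by rewrite /l ltnS leq_pmull // subn_gt0.
have cb : is_cycle (w :: b).
  split; last by rewrite /= szb; lia.
  apply/andP; split.
    move: szb sb (nthb 0 isT) (nthb (l.-1) (leqnn _)).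
    case: (b) => [|x b'] //= szb' sb'; rewrite addn0 => hx nl.
    rewrite adj_sym hx ai -hx /= rcons_path sb' /=.
    rewrite (last_nth x0) -[size b']/(size b').+1.-1 szb' nl /=.
    suff -> : i * q + (j - i) * q = j * q by [].
    by rewrite -mulnDl subnKC // ltnW.
  rewrite /=; have [[+ _] _ _ _ [zU _]] := st.
  rewrite cat_uniq => /and3P[ups _ _].
  have pfl : perm_eq (flatten ps) (flatten (p :: rem p ps)).
    by apply: perm_flatten; apply: perm_to_rem.
  have up : uniq p by move: ups; rewrite (perm_uniq pfl) /= cat_uniq => /and3P[].
  apply/andP; split; last by apply: take_uniq; apply: drop_uniq.
  move: wW; rewrite inE => /andP[+ wW]; apply: contra => wb; apply: zU => //.
  rewrite mem_cat; apply/orP; left; apply/flattenP; exists p => //.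
  by rewrite pE !mem_cat wb orbT.
(* Either remainder may be empty, and an empty path is not allowed in the family. *)
pose ne := [seq s <- [:: a; d] | s != [::]].
have fne : flatten ne = a ++ d.
  by rewrite /ne /=; case: (a) => [|? ?]; case: (d) => [|? ?] //=; rewrite ?cats0.
have pps' := perm_to_rem pps.
exists (ne ++ rem p ps), ((w :: b) :: cs), w; split=> //.
apply: (linkage_state_step st wW).
- apply/permP => P; have /permP/(_ P) := perm_flatten pps'.
  rewrite /= flatten_cat fne !count_cat /= !count_cat => ->.
  have -> : count P p = count P a + (count P b + count P d) by rewrite [in LHS]pE !count_cat.
  by move: (count P a) (count P d) (count P (flatten (rem p ps))) (count P b) => *; lia.
- move=> s; rewrite mem_cat => /orP[|/mem_rem /sps //].
  by rewrite mem_filter !inE => /andP[_ /orP[]/eqP->].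
- rewrite mem_cat negb_or mem_filter eqxx /=.
  by apply: contra nps => /mem_rem.
- move=> s; rewrite inE => /orP[/eqP ->|/cyc //].
  by split=> //=; rewrite szb; lia.
- rewrite size_cat (perm_size pps') /= doubleS !addnS.
  have : size ne <= 2 by rewrite size_filter; apply: leq_trans (count_size _ _) _.
  by move: (size ne) (size (rem p ps)) (size cs) => *; lia.
Qed.

(** Each move consumes a vertex of [W :\: U], so the moves stop. *)
Lemma linkage_terminates ps cs U : linkage_state ps cs U ->
  exists (ps' cs' : seq (seq G)) U', [/\ linkage_state ps' cs' U', size ps' < k &
    forall p, p \in ps' -> size p < k * q].
Proof.
have [t] := ubnP #|W :\: U|; elim: t ps cs U => // t IH ps cs U ltt st.
have dec w : w \in W :\: U -> #|W :\: (w |: U)| < t.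
  by move=> wW; move: ltt; rewrite (cardsD1 w) wW setDDl setUC.
have [leK|ltK] := leqP k (size ps).
  by have [ps' [w [/dec wW]]] := linkage_join st leK; apply: IH.
have [/allP small|] := boolP (all (fun p => size p < k * q) ps).
  by exists ps, cs, U.
rewrite -has_predC => /hasP[p pps]; rewrite /= -leqNgt => leKq.
by have [ps' [cs' [w [/dec wW]]]] := linkage_cut st pps leKq; apply: IH.
Qed.

(** In a final state an uncovered vertex lies outside [X] or on one of fewer than [k] remaining
    paths, each with fewer than [k * q] vertices. *)
Lemma cycles_of_linkage_state ps cs U : linkage_state ps cs U ->
  exists cs' : seq (seq G), [/\ size cs' <= C, forall s, s \in cs' -> is_cycle s,
    vdisjoint cs' & #|uncovered cs'| <= #|~: X| + k * (k * q)].
Proof.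
case/linkage_terminates=> ps' [cs' [U' [st ltk small]]].
have szC := linkage_state_cycles st.
case: st => -[uz _] _ cyc _ [_ Xz]; exists cs'; split=> //.
- by move=> s /cyc[].
- move: uz; rewrite cat_uniq => /and3P[_ _]; rewrite /vdisjoint.
  elim: (cs') => //= s ss IH; rewrite cat_uniq => /and3P[us nh uf].
  rewrite IH // andbT; apply/allP => u uss.
  rewrite disjoint_sym disjoint_has; apply: contra nh => /hasP[x xu xs].
  by apply/hasP; exists x => //; apply/flattenP; exists u.
- have sub : uncovered cs' \subset ~: X :|: [set x in flatten ps'].
    apply/subsetP=> x; rewrite !inE => /allP nx.
    case: (boolP (x \in X)) => //= /Xz; rewrite mem_cat => /orP[//|/flattenP[s scs xs]].
    by have := nx s scs; rewrite xs.
  apply: leq_trans (subset_leq_card sub) _.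
  apply: leq_trans (leq_card_setU _ _) _; rewrite leq_add2l cardsE.
  apply: leq_trans (card_size _) _.
  apply: (@leq_trans (size ps' * (k * q))); last by rewrite leq_mul2r ltnW ?orbT.
  elim: (ps') small => //= p pp IH small; rewrite size_cat mulSn leq_add //.
    by rewrite ltnW // small // mem_head.
  by apply: IH => u uu; apply: small; rewrite inE uu orbT.
Qed.

End Assemble.

(** * Nearly regular graphs *)

Import Order.TTheory GRing.Theory Num.Theory.
Local Open Scope ring_scope.

Lemma sum_card_color (V : finType) (r : nat) (f : V -> 'I_r) (P : pred 'I_r) (S : {set V}) :
  (\sum_(j < r | P j) #|S :&: [set v | f v == j]| = #|[set v in S | P (f v)]|)%N.
Proof.
rewrite -[RHS]sum1_card (partition_big f P) /=; last by move=> v; rewrite inE => /andP[].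
apply: eq_bigr => j Pj; rewrite -sum1_card; apply: eq_bigl => v.
by rewrite !inE; case: eqP => [->|]; rewrite ?Pj ?andbT ?andbF.
Qed.

Lemma sum_ord_ge (R : ringType) (r l : nat) (x : R) :
  \sum_(j < r | (l <= j)%N) x = (r - l)%:R * x.
Proof.
by rewrite -(big_geq_mkord l r xpredT (fun=> x)) sumr_const_nat mulr_natl.
Qed.

(** The class sizes inside [A i] have mean [#|A i| / r], so [r] times their squared deviation is [r]
    times the sum of squares minus [#|A i| ^ 2]; the previous averaging bound then applies. *)
Lemma exists_coloring_variance (R : realFieldType) (V I : finType) (r : nat)
    (A : I -> {set V}) : (0 < r)%N -> exists f : {ffun V -> 'I_r},
  \sum_i \sum_(j < r) (#|A i :&: [set v | f v == j]|%:R - #|A i|%:R / r%:R) ^+ 2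
    <= \sum_i #|A i|%:R :> R.
Proof.
move=> r_gt0; have [f fP] := exists_equidistributed_coloring A r_gt0; exists f.
have r0 : 0 < r%:R :> R by rewrite ltr0n.
have var i : r%:R * \sum_(j < r) (#|A i :&: [set v | f v == j]|%:R - #|A i|%:R / r%:R) ^+ 2
    = (r * \sum_(j < r) #|A i :&: [set v | f v == j]| ^ 2)%:R - (#|A i| ^ 2)%:R :> R.
  pose x j : R := #|A i :&: [set v | f v == j]|%:R; pose a : R := #|A i|%:R.
  have sx : \sum_(j < r) x j = a.
    rewrite -natr_sum (sum_card_color f xpredT); congr (_%:R); apply: eq_card => v.
    by rewrite inE andbT.
  transitivity (r%:R * (\sum_(j < r) (x j ^+ 2 + (- (2 * a / r%:R)) * x j + (a / r%:R) ^+ 2))).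
    by congr (_ * _); apply: eq_bigr => j _; rewrite /x /a; ring.
  rewrite !big_split /= -mulr_sumr sx sumr_const card_ord natrM natr_sum natrX -/a.
  under [X in _ = _ * X - _]eq_bigr do rewrite natrX.
  by rewrite -mulr_natl -/x; field; rewrite gt_eqF.
rewrite -(ler_pM2l r0) !mulr_sumr.
under eq_bigr do rewrite var.
rewrite sumrB lerBlDr -!natr_sum -mulr_sumr -natr_sum -natrM -natrD ler_nat.
by move: fP; rewrite big_split /= -!big_distrr /= addnC.
Qed.

(** Chebyshev's argument: the total squared deviation is at most twice [#|G| ^ 2], while each vertex
    of [B] contributes more than [(eta * #|G|) ^ 2]. Hence the bound on [B] does not depend on
    [#|G|]. *)
Lemma exists_concentrated_coloring (R : realType) (G : sgraph) (r : nat) (eta : R) :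
  (0 < r)%N -> (0 < #|G|)%N -> 0 < eta ->
  exists (f : {ffun G -> 'I_r}) (B : {set G}),
  [/\ #|B|%:R <= 2 / eta ^+ 2 :> R,
      forall v (j : 'I_r), v \notin B ->
        `|#|[set w | adj v w] :&: [set w | f w == j]|%:R - (deg v)%:R / r%:R|
          <= eta * #|G|%:R &
      forall j : 'I_r,
        (#|[set w | f w == j]|%:R - #|G|%:R / r%:R) ^+ 2 <= 2 * #|G|%:R :> R].
Proof.
move=> r_gt0 n_gt0 eta_gt0.
(* The right summand repeats the whole vertex set [#|G|] times, so that the
   variance of the class sizes is bounded after division by [#|G|]. *)
pose A (i : G + G) : {set G} := if i is inl v then [set w | adj v w] else [set: G].
have [f] := @exists_coloring_variance R _ _ r A r_gt0.
pose n : R := #|G|%:R; have n0 : 0 < n by rewrite ltr0n.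
pose dev v (j : 'I_r) : R := #|[set w | adj v w] :&: [set w | f w == j]|%:R - (deg v)%:R / r%:R.
pose dev' (j : 'I_r) : R := #|[set w | f w == j]|%:R - n / r%:R.
rewrite !big_sumType /=.
under [X in _ + X <= _]eq_bigr do under eq_bigr do rewrite setTI cardsT.
rewrite -[X in X + _ <= _]/(\sum_v \sum_j dev v j ^+ 2).
rewrite -[X in _ + X <= _]/(\sum_(v : G) \sum_j dev' j ^+ 2).
have constE (x : R) : \sum_(v : G) x = n * x.
  by rewrite sumr_const /n mulr_natl; congr (_ *+ _); apply: eq_card.
rewrite !constE cardsT -/n => le_total.
have {}le_total : \sum_v \sum_j dev v j ^+ 2 + n * \sum_j dev' j ^+ 2 <= 2 * n * n.
  apply: le_trans le_total _; rewrite (_ : 2 * n * n = n * n + n * n); last by ring.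
  rewrite lerD2r -constE.
  by apply: ler_sum => v _; rewrite ler_nat max_card.
have s1 : 0 <= \sum_v \sum_j dev v j ^+ 2.
  by apply: sumr_ge0 => v _; apply: sumr_ge0 => j _; apply: sqr_ge0.
have s2 : 0 <= \sum_j dev' j ^+ 2 by apply: sumr_ge0 => j _; apply: sqr_ge0.
pose B := [set v | [exists j, eta * n < `|dev v j|]].
exists f, B; split.
- have le1 : #|B|%:R * (eta * n) ^+ 2 <= \sum_v \sum_j dev v j ^+ 2.
    rewrite mulr_natl -sumr_const [leRHS](bigID (mem B)) /= -[leLHS]addr0 lerD //.
      apply: ler_sum => v; rewrite inE => /existsP[j ltj].
      rewrite (bigD1 j) //= -[leLHS]addr0 lerD //; last first.
        by apply: sumr_ge0 => i _; apply: sqr_ge0.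
      have -> : dev v j ^+ 2 = `|dev v j| ^+ 2 by rewrite real_normK ?num_real.
      have le0 : 0 <= eta * n by rewrite mulr_ge0 ?ltW.
      by rewrite ler_sqr ?nnegrE // ltW.
    by apply: sumr_ge0 => v _; apply: sumr_ge0 => i _; apply: sqr_ge0.
  rewrite ler_pdivlMr ?exprn_gt0 // -(ler_pM2r (exprn_gt0 2 n0)) -mulrA -exprMn.
  apply: le_trans le1 _; have := mulr_ge0 (ltW n0) s2.
  by move: le_total; rewrite expr2; lra.
- move=> v j; rewrite inE negb_exists => /forallP/(_ j).
  by rewrite -leNgt.
- move=> j; have le2 : dev' j ^+ 2 <= \sum_j dev' j ^+ 2.
    rewrite [leRHS](bigD1 j) //= -[leLHS]addr0 lerD //.
    by apply: sumr_ge0 => i _; apply: sqr_ge0.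
  apply: le_trans le2 _; rewrite -(ler_pM2l n0); move: le_total s1.
  by rewrite -/n; lra.
Qed.

(** Counting the edges from [T] to the next layers gives [L * #|T| <= U * #|neighbors N T|], hence
    Hall's condition with deficiency [D]. A path ends at an unmatched vertex or in the last layer
    [l.-1], which bounds the number of paths. *)
Lemma layered_path_cover (R : realFieldType) (G : sgraph) (r l D : nat)
    (f : G -> 'I_r) (Gd : {set G}) (L U : R) :
  (0 < l <= r)%N -> 0 < U ->
  (forall v j, v \in Gd -> L <= #|[set w in Gd | adj v w & f w == j]|%:R) ->
  (forall v j, v \in Gd -> #|[set w in Gd | adj v w & f w == j]|%:R <= U) ->
  L <= U -> (U - L) * #|G|%:R < U * D.+1%:R ->
  exists ps : seq (seq G),
    [/\ path_family ps, flatten ps =i [set v in Gd | (f v < l)%N] &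
        (size ps <= D + #|[set v | f v == l.-1 :> nat]|)%N].
Proof.
move=> /andP[l_gt0 le_lr] U_gt0 degL degU leLU UL.
pose N v := [set x in Gd | adj v x & f x == (f v).+1 :> nat].
pose A := [set v in Gd | ((f v).+1 < l)%N].
have [T sTA|g [gN gI gD]] := @hall_deficiency G G N A D.
  have dc : (\sum_(v in T) #|N v| =
             \sum_(x in neighbors N T) #|[set v in T | x \in N v]|)%N.
    under eq_bigr do rewrite -sum1_card.
    rewrite (exchange_big_dep (mem (neighbors N T))) /=; last first.
      by move=> v x vT xN; apply/bigcupP; exists v.
    apply: eq_bigr => x _; rewrite -sum1_card; apply: eq_bigl => v.
    by rewrite !inE.
  have lo : L * #|T|%:R <= (\sum_(v in T) #|N v|)%:R.
    rewrite mulrC mulr_natl -sumr_const natr_sum; apply: ler_sum => v vT.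
    have /(subsetP sTA) := vT; rewrite inE => /andP[vG ltv].
    have := degL v (Ordinal (leq_trans ltv le_lr)) vG.
    by rewrite (_ : [set w in Gd | _ & _] = N v) //; apply/setP => w; rewrite !inE.
  have hi : (\sum_(v in T) #|N v|)%:R <= U * #|neighbors N T|%:R.
    rewrite dc mulrC mulr_natl -sumr_const natr_sum; apply: ler_sum => x.
    case/bigcupP=> u uT; rewrite inE => /and3P[xG _ /eqP fx].
    have /(subsetP sTA) := uT; rewrite inE => /andP[uG ltu].
    (* Although [T] may meet many layers, the vertices whose [N] contains [x] all have the colour of
       [u], one less than that of [x], so a single upper degree bound suffices. *)
    apply: le_trans (degU x (f u) xG); rewrite ler_nat.
    apply/subset_leq_card/subsetP => v; rewrite !inE => /and4P[vT _ avx /eqP fv].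
    have /(subsetP sTA) := vT; rewrite inE => /andP[-> _]; rewrite adj_sym avx /=.
    by apply/eqP/val_inj => /=; lia.
  have leT : #|T|%:R <= #|G|%:R :> R by rewrite ler_nat max_card.
  (* Passing to a strict bound with [D.+1] lets [D] be a rounded-down quotient later. *)
  rewrite -ltnS -addnS -(ltr_nat R) natrD -(ltr_pM2l U_gt0) mulrDr.
  have h : (U - L) * #|T|%:R <= (U - L) * #|G|%:R by rewrite ler_wpM2l // subr_ge0.
  by move: h lo hi UL; lra.
have [v x vS gv|ps [pf cov sz _]] :=
    @layered_paths G (fun v => f v) g [set v in Gd | (f v < l)%N] _ gI.
  have [] := gN v x gv; rewrite !inE => /andP[vG ltv] /and3P[xG avx /eqP fx].
  by split=> //; rewrite ?xG ?fx ?ltnSn // -fx.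
exists ps; split=> //; rewrite sz.
have sub : [set v in [set v in Gd | (f v < l)%N] | g v == None] \subset
    [set v in A | g v == None] :|: [set v | f v == l.-1 :> nat].
  apply/subsetP=> v; rewrite !inE => /andP[/andP[vG ltv] ->]; rewrite vG andbT /=.
  by case: ltnP => //=; lia.
apply: leq_trans (subset_leq_card sub) _; apply: leq_trans (leq_card_setU _ _) _.
by rewrite leq_add2r.
Qed.

(** * Choice of the constants and assembly of the cycles *)

Theorem theorem2p1 (R : realType) (c alpha : R) (hc : 0 < c) (halpha : 0 < alpha) :
  exists (eps : R) (C : nat), 0 < eps /\ (0 < C)%N /\
  exists N : nat, forall n : nat, (N <= n)%N ->
  forall G : sgraph, #|G| = n ->
  (forall v : G, is_pm ((deg v)%:R : R) eps (c * n%:R)) ->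
  exists cs : seq (seq G),
    (size cs <= C)%N /\
    (forall s : seq G, s \in cs -> is_cycle s) /\
    vdisjoint cs /\
    (#|uncovered cs|%:R : R) <= alpha * n%:R.
Proof.
have archi (x y : R) : 0 < y -> exists2 k : nat, (0 < k)%N & x < k%:R * y.
  move=> y0; exists (Num.truncn `|x / y|).+1 => //; rewrite -ltr_pdivrMr //.
  by apply: le_lt_trans (ler_norm _) _; apply: truncnS_gt.
(* [w] is both the number of reservoir colours and the [k] of the linkage argument. With [y] the
   mean class size, [16 < w * c] makes reservoir degrees large compared with the [3 * y] paths. Then
   [r] makes [W] small, and [M] makes the [w] leftover paths of length below [w * (n %/ M)]
   negligible. *)
have [w w_gt0 wc] := archi 16 c hc.
have w0 : 0 < w%:R :> R by rewrite ltr0n.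
have [r0 _ r0a] := archi (8 * w%:R) alpha halpha.
pose r := (w + r0)%N.+1.
have r_gt0 : 0 < r%:R :> R by rewrite ltr0n.
have r_ge1 : 1 <= r%:R :> R by rewrite ler1n.
have ra : 8 * w%:R < r%:R * alpha.
  by apply: lt_le_trans r0a _; rewrite ler_pM2r // ler_nat /r ltnW // ltnS leq_addl.
have [M M_gt0 Ma] := archi (4 * w%:R ^+ 2) alpha halpha.
(* The three terms give, in order, a degree error small against [c * y], class sizes at most
   [2 * y], and an exceptional set of size at most [alpha * n / 4]. *)
pose eta := Num.min (c / (6 * r%:R ^+ 2)) (Num.min (1 / r%:R) (alpha / 4)).
have eta_gt0 : 0 < eta.
  by rewrite !lt_min !divr_gt0 ?mulr_gt0 ?exprn_gt0.
have eta_c : eta * (6 * r%:R ^+ 2) <= c.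
  by rewrite -ler_pdivlMr ?mulr_gt0 ?exprn_gt0 // ge_min lexx.
have eta_r : eta * r%:R <= 1.
  by rewrite -ler_pdivlMr // !ge_min lexx orbT.
have eta_a : eta * 4 <= alpha.
  by rewrite -ler_pdivlMr // !ge_min lexx !orbT.
pose eps := 1 / (4 * r%:R) : R.
have eps_gt0 : 0 < eps by rewrite divr_gt0 ?mulr_gt0.
have eps_r : eps * r%:R = 1 / 4 by rewrite /eps; field; rewrite gt_eqF.
have eps_le : eps <= 1 / 4 by rewrite -eps_r ler_peMr // ltW.
have [N0 N0_gt0 N0P] := archi (2 / eta ^+ 2) eta eta_gt0.
have [N1 N1_gt0 N1P] := archi (2 / eta ^+ 2) 1 ltr01.
(* Cycles have at least [q = n %/ M] vertices, and [q * (2 * M + 1)] exceeds [n] once [M <= n]. *)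
exists eps, M.*2; split=> //; split; first by rewrite double_gt0.
exists (N0 + N1 + M + 4 * M * r)%N => n leN G cardG deg_pm.
have [n_gt0 [leN0 [leN1 [leMn leMr]]]] :
    (0 < n /\ N0 <= n /\ N1 <= n /\ M <= n /\ 4 * M * r <= n)%N.
  by clear -leN N0_gt0; lia.
have n0 : 0 < n%:R :> R by rewrite ltr0n.
have [x0 _] : exists x : G, x \in G by apply/card_gt0P; rewrite cardG.
have [|f [B [cardB devN devV]]] := @exists_concentrated_coloring R G r eta isT _ eta_gt0.
  by rewrite cardG.
rewrite cardG in devN devV.
have bn : 2 / eta ^+ 2 <= eta * n%:R.
  by apply: ltW; apply: lt_le_trans N0P _; rewrite mulrC ler_pM2l // ler_nat.
have bn1 : 2 / eta ^+ 2 <= n%:R.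
  by apply: ltW; apply: lt_le_trans N1P _; rewrite mulr1 ler_nat.
pose y : R := n%:R / r%:R.
have y_gt0 : 0 < y by rewrite divr_gt0.
have nE : n%:R = r%:R * y by rewrite /y; field; rewrite gt_eqF.
have etan_y : eta * n%:R <= y by rewrite nE mulrA ger_pMl.
have etan_c : eta * n%:R * (6 * r%:R) <= c * y.
  rewrite nE (_ : _ * _ = eta * (6 * r%:R ^+ 2) * y); last by ring.
  by rewrite ler_pM2r.
have B_etan : #|B|%:R <= eta * n%:R := le_trans cardB bn.
have My : 4 * M%:R <= y.
  by rewrite /y ler_pdivlMr // -!natrM ler_nat.
have classV (j : 'I_r) : #|[set v | f v == j]|%:R <= 2 * y.
  have : #|[set v | f v == j]|%:R - y <= eta * n%:R.
    apply: le_trans (ler_norm _) _; have le0 : 0 <= eta * n%:R by rewrite mulr_ge0 ?ltW.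
    rewrite -ler_sqr ?nnegrE // real_normK ?num_real //; apply: le_trans (devV j) _.
    rewrite (_ : (eta * n%:R) ^+ 2 = n%:R * eta ^+ 2 * n%:R); last by ring.
    by rewrite ler_pM2r // -ler_pdivrMr ?exprn_gt0.
  by move: etan_y; lra.
have deg_bounds (v : G) : (1 - eps) * c * y <= (deg v)%:R / r%:R <= (1 + eps) * c * y.
  have [x [/andP[x1 x2] ->]] := deg_pm v.
  rewrite nE (_ : x * _ / _ = x * (c * y)); last by field; rewrite gt_eqF.
  have cy : 0 < c * y by rewrite mulr_gt0.
  by rewrite -![_ * c * y]mulrA (ler_pM2r cy) (ler_pM2r cy) (ltW x1) (ltW x2).
pose Gd := ~: B.
pose l := (r - w)%N.
have [l_gt0 le_lr rlw lt_l] : [/\ 0 < l, l <= r, r - l = w & l.-1 < r]%N.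
  by rewrite /l /r; clear; split; lia.
(* One [eta * n] is the concentration error, the other the loss from deleting [B]. *)
pose L := (1 - eps) * c * y - 2 * (eta * n%:R).
pose U := (1 + eps) * c * y + eta * n%:R.
have degBnd (v : G) (j : 'I_r) : v \in Gd ->
    (1 - eps) * c * y - eta * n%:R <= #|[set u | adj v u] :&: [set u | f u == j]|%:R <= U.
  rewrite inE => vB; have := devN v j vB; rewrite ler_norml.
  by have := deg_bounds v; rewrite /U; lra.
have interB (v : G) (j : 'I_r) : ([set u in Gd | adj v u & f u == j] =
    ([set u | adj v u] :&: [set u | f u == j]) :\: B).
  by apply/setP => u; rewrite !inE.
have cardDB (S : {set G}) : #|S|%:R - eta * n%:R <= #|S :\: B|%:R :> R.
  rewrite lerBlDr; apply: (@le_trans _ _ (#|S :\: B|%:R + #|B|%:R)); last by rewrite lerD2l.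
  rewrite -natrD ler_nat -(cardsID B S) addnC leq_add2l.
  by apply/subset_leq_card/subsetIr.
have cy_gt0 : 0 < c * y by rewrite mulr_gt0.
have ecy : 0 < eps * (c * y) by rewrite mulr_gt0.
have eta_n0 : 0 < eta * n%:R by rewrite mulr_gt0.
have U_gt : c * y <= U by rewrite /U; lra.
have [||||||ps [[ups sps nps] cov sz]] := @layered_path_cover R G r l (n %/ r) f Gd L U.
- by rewrite l_gt0.
- by apply: lt_le_trans U_gt.
- move=> v j vG; rewrite interB; apply: le_trans (cardDB _).
  by have := degBnd v j vG; rewrite /L; lra.
- move=> v j vG; rewrite interB; have /andP[_] := degBnd v j vG; apply: le_trans.
  by rewrite ler_nat; apply/subset_leq_card/subsetDl.
- by rewrite /L /U; lra.
- rewrite cardG; apply: (@le_lt_trans _ _ (U * y)).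
    (* Since [eps * r = 1 / 4], the degree spread contributes [c * y / 2]; the choice of [eta]
       bounds the error terms by another [c * y / 2]. *)
    apply: (@le_trans _ _ (c * y * y)); last by rewrite ler_pM2r.
    rewrite (_ : (U - L) * _ = (2 * (eps * r%:R) * (c * y) + 3 * (eta * n%:R * r%:R)) * y);
      last by rewrite /U /L nE; ring.
    by rewrite ler_pM2r // eps_r; lra.
  rewrite ltr_pM2l; last exact: lt_le_trans U_gt.
  by rewrite /y ltr_pdivrMr // -natrM ltr_nat ltn_ceil.
(* At most [y] unmatched vertices, plus a last class of at most [2 * y]. *)
have sz_ps : (size ps)%:R <= 3 * y.
  have le1 : (n %/ r)%:R <= y by rewrite /y ler_pdivlMr // -natrM ler_nat leq_trunc_div.
  have := classV (Ordinal lt_l).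
  rewrite (_ : [set v | f v == Ordinal lt_l] = [set v | f v == l.-1 :> nat]) //.
  by move: sz; rewrite -(ler_nat R) natrD; lra.
pose W := [set v in Gd | (l <= f v)%N].
pose q := (n %/ M)%N.
have cardW : #|W|%:R <= w%:R * (2 * y).
  apply: (@le_trans _ _ #|[set v in [set: G] | (l <= f v)%N]|%:R).
    by rewrite ler_nat; apply/subset_leq_card/subsetP => v; rewrite !inE => /andP[].
  rewrite -(sum_card_color f (fun j => (l <= j)%N)) natr_sum.
  apply: (@le_trans _ _ (\sum_(j < r | (l <= j)%N) (2 * y))).
    by apply: ler_sum => j _; rewrite setTI.
  by rewrite sum_ord_ge rlw.
have wcy : 16 * y <= w%:R * (c * y).
  by rewrite mulrA ler_pM2r // ltW.
(* [7 / 12 = 1 - 1 / 4 - 1 / 6], from [eps <= 1 / 4] and [6 * eta * n <= c * y]; the final [y] pays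
   for deleting [B]. *)
have degW (v : G) : v \in Gd -> w%:R * (c * y) * (7 / 12) - y <= #|[set u in W | adj v u]|%:R.
  move=> vG.
  have -> : [set u in W | adj v u] = [set u in [set u | adj v u] | (l <= f u)%N] :\: B.
    by apply/setP => u; rewrite !inE -!andbA; congr (_ && _); rewrite andbC.
  apply: le_trans (cardDB _); apply: lerB => //.
  rewrite -(sum_card_color f (fun j => (l <= j)%N)) natr_sum.
  apply: (@le_trans _ _ (\sum_(j < r | (l <= j)%N) (c * y * (7 / 12)))).
    by rewrite sum_ord_ge rlw -mulrA.
  apply: ler_sum => j _; have /andP[+ _] := degBnd v j vG; apply: le_trans.
  have : eta * n%:R * 6 <= eta * n%:R * (6 * r%:R) by rewrite ler_pM2l //; lra.
  have : eps * (c * y) <= 1 / 4 * (c * y) by rewrite ler_pM2r.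
  by move: etan_c; lra.
(* The initial state has the layered paths, no cycle and an untouched reservoir. *)
have [|||||cs [szC cyc dis unc]] := @cycles_of_linkage_state G x0 W Gd
    [set v in Gd | (f v < l)%N] w q (size ps) M.*2 w_gt0 _ _ _ _ ps [::] set0.
- by rewrite divn_gt0.
- by apply/subsetP => v; rewrite inE => /andP[].
- move=> v vG; set d := #|[set u in W | adj v u]|.
  have dW := degW v vG; rewrite -/d in dW.
  have big : #|W|%:R < w%:R * (d%:R - ((size ps)%:R + 4 * M%:R)) :> R.
    apply: le_lt_trans cardW _; rewrite ltr_pM2l //.
    by move: y_gt0; lra.
  have leM : (size ps + M.*2.*2 <= d)%N.
    rewrite -(ler_nat R) natrD -!muln2 !natrM; by move: y_gt0; lra.
  by rewrite -(ltr_nat R) natrM natrB // natrD -!muln2 !natrM; move: big; lra.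
- rewrite cardG /q; have := divn_eq n M; have := ltn_pmod n M_gt0.
  have : (0 < n %/ M)%N by rewrite divn_gt0.
  by clear; nia.
- split=> //=; rewrite ?cats0 //.
  + by split=> // v; rewrite cov inE => /andP[].
  + by rewrite sub0set cards0 addn0.
  + split=> v; rewrite cov inE => // /andP[_ ltv]; rewrite inE => /andP[_].
    by rewrite leqNgt ltv.
exists cs; do !split=> //.
(* The exceptional set, the reservoir and the leftover paths each cost at most [alpha * n / 4]. *)
have cX : (#|~: [set v in Gd | (f v < l)%N]| <= #|B| + #|W|)%N.
  apply: leq_trans (leq_card_setU B W); apply/subset_leq_card/subsetP => v.
  by rewrite !inE negb_and negbK -leqNgt; case: (v \in B).
have leq_q : (w * (w * q))%:R * 4 <= alpha * n%:R.
  have qM : q%:R * M%:R <= n%:R :> R by rewrite -natrM ler_nat leq_trunc_div.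
  have q0 : 0 <= q%:R :> R by rewrite ler0n.
  rewrite !natrM (_ : _ * 4 = 4 * w%:R ^+ 2 * q%:R); last by ring.
  apply: (@le_trans _ _ (M%:R * alpha * q%:R)); first by rewrite ler_wpM2r // ltW.
  by rewrite (_ : M%:R * alpha * q%:R = alpha * (q%:R * M%:R)) ?ler_pM2l //; ring.
have aW : #|W|%:R * 4 <= alpha * n%:R.
  apply: (@le_trans _ _ (8 * w%:R * y)); first by move: cardW; lra.
  by rewrite nE mulrA [alpha * _]mulrC ler_pM2r // ltW.
have aB : #|B|%:R * 4 <= alpha * n%:R.
  apply: (@le_trans _ _ (eta * 4 * n%:R)); first by move: B_etan; lra.
  by rewrite ler_pM2r.
have : #|uncovered cs|%:R <= #|B|%:R + #|W|%:R + (w * (w * q))%:R :> R.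
  by rewrite -!natrD ler_nat; apply: leq_trans unc _; rewrite leq_add2r.
have : 0 < alpha * n%:R by rewrite mulr_gt0.
by move: leq_q aW aB; lra.
Qed.
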